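(* A group $G$ is bi-orderable if and only if for every nontrivial finitely normally generated subgroup $N$ of $G$ there exist a group $H$ and a surjective homomorphism $\phi : G \to H$ satisfying: (1) $\phi(N)$ is nontrivial, and (2) $\phi(N)$ admits a bi-ordering that is invariant under conjugation by elements of $H$.
   Context: A \emph{bi-ordering} of a group $G$ is a strict total ordering $<$ of $G$ such that $g<h$ implies both $fg<fh$ and $gf<hf$ for all $f,g,h \in G$; $G$ is \emph{bi-orderable} if it admits a bi-ordering. A subgroup $N$ of $G$ is \emph{finitely normally generated} if there are finitely many elements $x_1, \ldots, x_n \in G$ such that $N$ is the smallest normal subgroup of $G$ containing $x_1, \ldots, x_n$. A bi-ordering $<$ of the (normal) subgroup $\phi(N)$ of $H$ is invariant under conjugation by elements of $H$ if $a<b$ implies $hah^{-1} < hbh^{-1}$ for all $a,b \in \phi(N)$ and $h \in H$. *)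

(* Defs.v *)
From mathcomp Require Import all_boot.
From mathcomp Require Import boolp classical_sets.

Set Implicit Arguments.
Unset Strict Implicit.
Unset Printing Implicit Defensive.

Local Open Scope classical_set_scope.
Local Open Scope group_scope.

(* Groups are arbitrary (possibly infinite) [groupType]s.  Subgroups are plain
   subsets [set G]; the predicates below carry the closure conditions. *)

Definition is_subgroup (G : groupType) (N : set G) : Prop :=
  [/\ N 1,
      forall x y, N x -> N y -> N (x * y)
    & forall x, N x -> N x^-1].

Definition is_normal_subgroup (G : groupType) (N : set G) : Prop :=
  is_subgroup N /\ forall g x, N x -> N (g * x * g^-1).

Definition nontrivial (G : groupType) (N : set G) : Prop := N <> [set 1].

(* [smallest C X] is the intersection of all sets containing X and satisfying
   C; normal subgroups are stable under intersection, so this is the smallest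
   normal subgroup containing X. *)
Definition normal_closure (G : groupType) (X : set G) : set G :=
  smallest (@is_normal_subgroup G) X.

Definition finitely_normally_generated (G : groupType) (N : set G) : Prop :=
  exists s : seq G, N = normal_closure [set` s].

(* A bi-ordering of a subgroup A of G is encoded as a relation on all of G of
   which only the restriction to A matters. *)
Definition strict_total_order_on (T : Type) (A : set T) (lt : T -> T -> Prop) :
    Prop :=
  [/\ forall x, A x -> ~ lt x x,
      forall x y z, A x -> A y -> A z -> lt x y -> lt y z -> lt x z
    & forall x y, A x -> A y -> x <> y -> lt x y \/ lt y x].

Definition bi_ordering_on (G : groupType) (A : set G) (lt : G -> G -> Prop) :
    Prop :=
  strict_total_order_on A lt /\
  forall f g h, A f -> A g -> A h -> lt g h ->
    lt (f * g) (f * h) /\ lt (g * f) (h * f).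

Definition bi_orderable (G : groupType) : Prop :=
  exists lt : G -> G -> Prop, bi_ordering_on [set: G] lt.

Definition conj_invariant_on (H : groupType) (A : set H)
    (lt : H -> H -> Prop) : Prop :=
  forall a b h, A a -> A b -> lt a b -> lt (h * a * h^-1) (h * b * h^-1).

(* Main.v *)
Require Import Defs.
From mathcomp Require Import all_boot.
From mathcomp Require Import boolp classical_sets filter.

(** A bi-ordering amounts to a positive cone: a conjugation-invariant
    subsemigroup [P] avoiding [1] and containing [x] or [x^-1] for every
    [x <> 1].  By compactness it is enough to find, for each finite list [s],
    such a [P] that only has to decide the elements of [s].  This is done by
    induction on the size of [s]: the quotient [phi] attached to the normal
    closure of [s] decides the elements of [s] outside its kernel, and there are
    strictly fewer elements of [s] left inside the kernel; the two cones are
    combined lexicographically. *)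

Set Implicit Arguments.
Unset Strict Implicit.
Unset Printing Implicit Defensive.

Local Open Scope classical_set_scope.
Local Open Scope group_scope.

Definition conj_cone (G : groupType) (P : set G) : Prop :=
  [/\ ~ P 1,
      forall x y, P x -> P y -> P (x * y)
    & forall g x, P x -> P (g * x * g^-1)].

Definition decides (G : groupType) (P : set G) (x : G) : Prop :=
  x <> 1 -> P x \/ P x^-1.

Lemma normal_closure_normal (G : groupType) (X : set G) :
  is_normal_subgroup (normal_closure X).
Proof.
split; first split.
- by move=> M [[[]]].
- move=> x y Nx Ny M MX; have [[[_ mulM _] _] _] := MX.
  by apply: mulM; [exact: Nx | exact: Ny].
- move=> x Nx M MX; have [[[_ _ invM] _] _] := MX.
  by apply: invM; exact: Nx.
- move=> g x Nx M MX; have [[_ conjM] _] := MX.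
  by apply: conjM; exact: Nx.
Qed.

Lemma kernel_normal (G H : groupType) (phi : {multiplicative G -> H}) :
  is_normal_subgroup [set x | phi x = 1].
Proof.
have phi1 : phi 1 = 1 by apply: (@mulgI _ (phi 1)); rewrite -gmulfM !mulg1.
split; first split => //=.
- by move=> x y px py; rewrite gmulfM px py mulg1.
- by move=> x px; apply: (@mulgI _ (phi x)); rewrite -gmulfM mulgV phi1 px mulg1.
- by move=> g x /= px; rewrite !gmulfM px mulg1 -gmulfM mulgV.
Qed.

Lemma nontrivial_neq1 (G : groupType) (N : set G) :
  is_subgroup N -> nontrivial N <-> exists2 x, N x & x <> 1.
Proof.
move=> [N1 _ _]; split=> [ntN|[x Nx x1] N_1]; last by apply: x1; rewrite N_1 in Nx.
apply: contrapT => no; apply: ntN; rewrite eqEsubset; split=> [x Nx|x ->] //.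
by apply: contrapT => x1; apply: no; exists x.
Qed.

(** Left translation does not change [x^-1 * y], so left invariance is immediate. Right translation
    by [f] conjugates it by [f^-1], which is where conjugation invariance of [P] enters. *)
Lemma bi_orderable_of_cone (G : groupType) (P : set G) :
  conj_cone P -> (forall x, decides P x) -> bi_orderable G.
Proof.
move=> [P1 mulP conjP] decP; exists (fun x y => P (x^-1 * y)); split; first split.
- by move=> x _; rewrite mulVg.
- move=> x y z _ _ _ Pxy Pyz.
  have -> : x^-1 * z = (x^-1 * y) * (y^-1 * z) by rewrite mulgA mulgK.
  exact: mulP.
- move=> x y _ _ xy.
  have [| Pxy | Pyx] := decP (x^-1 * y); first 1 last.
  + by left.
  + by right; rewrite invgM invgK in Pyx.
  + by move=> /(canRL (mulVKg _)); rewrite mulg1 => yx; apply: xy.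
- move=> f g h _ _ _ Pgh; split; first by rewrite invgM -mulgA mulKg.
  by have := conjP f^-1 _ Pgh; rewrite invgK invgM !mulgA.
Qed.

Section Compactness.
Variables (G : groupType) (C : seq G -> set G).
Hypothesis coneC : forall s, conj_cone (C s).
Hypothesis decC : forall s x, x \in s -> decides (C s) x.

(** The cone is the limit of the [C t] along an ultrafilter on finite lists: [x] is positive when it
    lies in [C t] for almost every [t]. Each cone axiom involves only finitely many elements, so it
    passes to the limit. *)
Lemma cone_of_local_cones : exists2 P : set G, conj_cone P & forall x, decides P x.
Proof.
pose above (s : seq G) := [set t : seq G | {subset s <= t}].
have above_filter : Filter (filter_from setT above).
  apply: filter_fromT_filter; first by exists [::].
  move=> s t; exists (s ++ t) => u stu.
  by split=> x xs; apply: stu; rewrite mem_cat xs ?orbT.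
(* The sets [above s] generate a proper filter, since [s] itself lies in [above s]; extend it to an
   ultrafilter. *)
have [|U [ultraU aboveU]] := @ultraFilterLemma _ (filter_from setT above).
  by apply: filter_from_proper => s _; exists s.
have eventually_mem x : U [set t | x \in t].
  by apply: aboveU; exists [:: x] => // t; apply; rewrite mem_head.
exists [set x | U [set t | C t x]]; first split => /=.
- move=> /filter_ex [t]; by have [] := coneC t.
- move=> x y Ux Uy; apply: filterS (filterI Ux Uy) => t [].
  by have [_ mulC _] := coneC t; exact: mulC.
- move=> g x; apply: filterS => t.
  by have [_ _ conjC] := coneC t; exact: conjC.
move=> x x1 /=.
have [Ux|Unx] := in_ultra_setVsetC [set t | C t x] ultraU; [by left|right].
(* Almost every [t] lists [x] yet has [x] outside [C t]; as [C t] decides [x], it contains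
   [x^-1]. *)
by apply: filterS (filterI (eventually_mem x) Unx) => t [xt nCtx]; case: (decC xt).
Qed.

End Compactness.

Section Lexicographic.
Variables (G H : groupType) (phi : {multiplicative G -> H}) (N : set G).
Variables (lt : H -> H -> Prop) (P : set G).
Hypothesis normalN : is_normal_subgroup N.
Hypothesis orderN : bi_ordering_on (phi @` N) lt.
Hypothesis conj_lt : conj_invariant_on (phi @` N) lt.
Hypothesis coneP : conj_cone P.

(** The sign of the image comes first, and [P] breaks ties on the kernel. The membership clause is
    there because [lt] is an order only on the image of [N]. *)
Definition lex_cone : set G :=
  [set x | (phi @` N) (phi x) /\ lt 1 (phi x) \/ phi x = 1 /\ P x].

Let phi1 : phi 1 = 1.
Proof. by have [[]] := kernel_normal phi. Qed.

Let phiV x : phi x^-1 = (phi x)^-1.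
Proof. by apply: (@mulgI _ (phi x)); rewrite -gmulfM !mulgV. Qed.

Let imN1 : (phi @` N) 1.
Proof. by have [[N1 _ _] _] := normalN; exists 1. Qed.

Lemma lex_cone_conj_cone : conj_cone lex_cone.
Proof.
have [[irr trans _] mono] := orderN; have [P1 mulP conjP] := coneP.
have [[_ mulN _] conjN] := normalN.
split=> [[[_]|[_ /P1]]| x y | g x] //; first by rewrite phi1; exact: irr.
- move=> [[Nx x_pos]|[x1 Px]] [[Ny y_pos]|[y1 Py]]; rewrite /lex_cone /= gmulfM.
  + have Nxy : (phi @` N) (phi x * phi y).
      have [[a Na <-] [b Nb <-]] := (Nx, Ny).
      by exists (a * b); [exact: mulN | exact: gmulfM].
    left; split=> //; apply: (trans _ (phi x)) => //.
    by have [] := mono _ _ _ Nx imN1 Ny y_pos; rewrite mulg1.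
  + by left; rewrite y1 mulg1.
  + by left; rewrite x1 mul1g.
  + by right; rewrite x1 y1 mulg1; split=> //; exact: mulP.
(* Here [g] ranges over all of [G], so [phi g] may lie outside the image of [N]: compatibility of
   [lt] with products in that image would not suffice, and [conj_lt] is used. *)
- rewrite /lex_cone /= !gmulfM phiV => -[[Nx x_pos]|[x1 Px]].
    left; split; last by have := conj_lt (phi g) imN1 Nx x_pos; rewrite mulg1 mulgV.
    have [a Na <-] := Nx; exists (g * a * g^-1); first exact: conjN.
    by rewrite !gmulfM phiV.
  by right; rewrite x1 mulg1 mulgV; split=> //; exact: conjP.
Qed.

Lemma lex_cone_decides x :
  N x -> (phi x = 1 -> decides P x) -> decides lex_cone x.
Proof.
have [[_ trans tot] mono] := orderN; have [[_ _ invN] _] := normalN.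
move=> Nx decPx x1; have [px|px] := pselect (phi x = 1).
  by have [Px|Px] := decPx px x1; [left|right]; right; rewrite ?phiV px ?invg1.
have imx : (phi @` N) (phi x) by exists x.
have imVx : (phi @` N) (phi x)^-1 by exists x^-1; [exact: invN|exact: phiV].
have [|||pos|neg] := tot 1 (phi x) => //; first by move=> /esym.
  by left; left.
right; left; rewrite phiV; split=> //.
(* Multiplying [lt (phi x) 1] by [(phi x)^-1] makes the inverse positive. *)
by have [] := mono _ _ _ imVx imx imN1 neg; rewrite mulVg mulg1.
Qed.

End Lexicographic.

Lemma local_cone (G : groupType) :
  (forall N : set G, is_subgroup N -> nontrivial N ->
     finitely_normally_generated N ->
     exists (H : groupType) (phi : {multiplicative G -> H}),
       nontrivial (phi @` N) /\
       exists lt : H -> H -> Prop,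
         bi_ordering_on (phi @` N) lt /\ conj_invariant_on (phi @` N) lt) ->
  forall s : seq G, exists2 P : set G, conj_cone P & forall x, x \in s -> decides P x.
Proof.
move=> quot s; have [n] := ubnP (size s); elim: n s => // n IHn s size_s.
(* If all entries of [s] are trivial, nothing needs deciding and the empty cone works. *)
have [s1|/existsNP[y /not_implyP[ys y1]]] :=
  pselect (forall x, x \in s -> x = 1).
  exists set0 => [|x /s1 -> /(_ erefl)] //; split=> //.
pose N := normal_closure [set` s]; have normalN : is_normal_subgroup N.
  exact: normal_closure_normal.
have sN x : x \in s -> N x by move=> xs M [_]; exact.
have ntN : nontrivial N.
  by apply/nontrivial_neq1; [case: normalN | exists y => //; exact: sN].
have [H [phi [ntphiN [lt [orderN conj_lt]]]]] :=
  quot N normalN.1 ntN (ex_intro _ s erefl).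
(* Otherwise the kernel, being normal and containing [s], would contain [N], and the image of [N]
   would be trivial. *)
have [z zs z1] : exists2 z, z \in s & phi z <> 1.
  apply: contrapT => s_ker; apply: ntphiN.
  have N_ker : N `<=` [set x | phi x = 1].
    apply: smallest_sub; first exact: kernel_normal.
    by move=> x /= xs; apply: contrapT => x1; apply: s_ker; exists x.
  have [[N1 _ _] _] := normalN.
  rewrite eqEsubset; split=> [_ [x /N_ker x1 <-] //|_ ->].
  by exists 1 => //; exact: N_ker.
(* Induct on the entries inside the kernel; the list is strictly shorter because [z] has been
   dropped. *)
have [|P coneP decP] := IHn [seq x <- s | phi x == 1].
  apply: leq_trans (_ : size s <= n); last by rewrite -ltnS.
  rewrite size_filter -[ltnRHS](count_predC (fun x => phi x == 1)) -addn1 leq_add2l.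
  by rewrite -has_count; apply/hasP; exists z => //=; apply/eqP.
exists (lex_cone phi N lt P); first exact: lex_cone_conj_cone.
move=> x xs; apply: lex_cone_decides => //; first exact: sN.
by move=> x1; apply: decP; rewrite mem_filter x1 eqxx.
Qed.

Theorem theorem2p4 (G : groupType) :
  bi_orderable G <->
  (forall N : set G, is_subgroup N -> nontrivial N ->
     finitely_normally_generated N ->
     exists (H : groupType) (phi : {multiplicative G -> H}),
       [/\ range phi = [set: H],
           nontrivial (phi @` N)
         & exists lt : H -> H -> Prop,
             bi_ordering_on (phi @` N) lt /\
             conj_invariant_on (phi @` N) lt]).
Proof.
split=> [[lt [[irr trans tot] mono]] N _ ntN _|quot].
  (* The identity of [G] serves for every [N]: conjugation by [h] is a left translation by [h]
     followed by a right translation by [h^-1], and both preserve [lt]. *)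
  exists G, (@idfun G : {multiplicative G -> G}); rewrite !image_id; split=> //.
  exists lt; split=> [|a b h _ _ ab]; last first.
    have [hab _] := mono h a b I I I ab.
    by have [] := mono h^-1 _ _ I I I hab.
  split; first split=> [x _|x y z _ _ _|x y _ _].
  - exact: irr.
  - exact: trans.
  - exact: tot.
  - by move=> f g h _ _ _; exact: mono.
have /choice[C CP] (s : seq G) :
    exists P : set G, conj_cone P /\ forall x, x \in s -> decides P x.
  have [N sgN ntN fgN|P ? ?] := @local_cone G _ s; last by exists P.
  by have [H [phi [_ ? ?]]] := quot N sgN ntN fgN; exists H, phi.
have [|s|P] := @cone_of_local_cones G C; [by move=> s; case: (CP s)|by case: (CP s)|].
exact: bi_orderable_of_cone.
Qed.
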